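(* Let $D$ be a loopless multigraph on the vertex set of $K_n$ with at most $2n-5$ edges, such that every vertex has degree at most $n-1$ in $D$. Then $D$ is realizable in $K_n$.
   Context: Given a simple graph $G$ and a multigraph $D$ with $V(D)=V(G)$, $D$ is realizable in $G$ if there exist pairwise edge-disjoint paths in $G$, one for each edge of $D$ (parallel edges counted separately), each joining the two endpoints of its edge. *)

(* Defs.v *)
From mathcomp Require Import all_boot.

Set Implicit Arguments.
Unset Strict Implicit.
Unset Printing Implicit Defensive.

Record simple_graph (V : finType) := SimpleGraph {
  adj :> rel V;
  adj_sym : symmetric adj;
  adj_irrefl : irreflexive adj
}.

(* Edges have an identity of their own, so that parallel edges are distinct.
   The order of the two endpoints of an edge is immaterial. *)
Record multigraph (V : finType) := Multigraph {
  medge : finType;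
  mend1 : medge -> V;
  mend2 : medge -> V
}.

Definition loopless (V : finType) (D : multigraph V) : Prop :=
  forall e : medge D, mend1 e != mend2 e.

Definition num_edges (V : finType) (D : multigraph V) : nat := #|medge D|.

(* A loop counts twice. *)
Definition degree (V : finType) (D : multigraph V) (v : V) : nat :=
  #|[set e : medge D | mend1 e == v]| + #|[set e : medge D | mend2 e == v]|.

(* The vertex sequence x :: p is a path of G (no repeated vertex) from x to y. *)
Definition is_path (V : finType) (G : simple_graph V) (x y : V) (p : seq V)
  : bool := [&& path G x p, last x p == y & uniq (x :: p)].

(* The edges of the walk x :: p, as unordered pairs of consecutive vertices. *)
Definition path_edges (V : finType) (x : V) (p : seq V) : {set {set V}} :=
  [set:: [seq [set uv.1; uv.2] | uv <- zip (x :: p) p]].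

Definition realizable (V : finType) (G : simple_graph V) (D : multigraph V)
  : Prop :=
  exists P : medge D -> seq V,
    (forall e, is_path G (mend1 e) (mend2 e) (P e)) /\
    (forall e f, e != f ->
       [disjoint path_edges (mend1 e) (P e) & path_edges (mend1 f) (P f)]).

Definition complete_adj (n : nat) : rel 'I_n := fun x y => x != y.

Lemma complete_adj_sym (n : nat) : symmetric (@complete_adj n).
Proof. by move=> x y; rewrite /complete_adj eq_sym. Qed.

Lemma complete_adj_irrefl (n : nat) : irreflexive (@complete_adj n).
Proof. by move=> x; rewrite /complete_adj eqxx. Qed.

Definition complete_graph (n : nat) : simple_graph 'I_n :=
  SimpleGraph (@complete_adj_sym n) (@complete_adj_irrefl n).

(* Main.v *)
Require Import Defs.
From mathcomp Require Import all_boot zify.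

(* Induction on the number n of vertices. If there are fewer than 2n - 5 demands,
   add demands between vertices of small degree, so assume equality. Eliminate a
   vertex v of minimum degree (at most 3): a demand vu takes the edge vu or is
   replaced by wu through the edge vw; a demand xy elsewhere is served by x-v-y, or
   replaced by zy through x-v-z. What remains is a problem on n - 1 vertices, and
   two demands must have been served and every vertex of degree n - 1 must have
   lost a demand. As the degrees sum to 4n - 10, at most three vertices have degree
   at least n - 2, and fewer when v has positive degree: at most one if v has degree
   2, and none if v has degree 3. If v is isolated, one needs two disjoint demands
   covering the vertices of degree n - 1; the only obstruction is that all demands
   lie on a triangle, which is served directly. *)

Set Implicit Arguments.
Unset Strict Implicit.
Unset Printing Implicit Defensive.

(** * Routing by edge-disjoint connecting sets *)

Section Routing.
Variable V : finType.
Implicit Types (x y z u v w : V) (S T e f : {set V}).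
Implicit Types (E F : {set {set V}}) (D : seq {set V}).

Definition link F : rel V := fun x y => [set x; y] \in F.

Lemma connect_linkC F : connect_sym (link F).
Proof. by apply: sym_connect_sym => x y; rewrite /link setUC. Qed.

Lemma connect_link_subset E F x y :
  F \subset E -> connect (link F) x y -> connect (link E) x y.
Proof.
move=> sFE; apply: connect_sub => a b ab; apply: connect1.
exact: (subsetP sFE).
Qed.

(* A demand is the set of its two endpoints; it is served by a set [F] of edges
   connecting them, and distinct demands get disjoint sets. *)
Fixpoint routable E D : Prop :=
  if D is e :: D' then
    exists F, [/\ F \subset E, {in e &, forall x y, connect (link F) x y}
                & routable (E :\: F) D']
  else True.

Lemma routable_subset E1 E2 D : E1 \subset E2 -> routable E1 D -> routable E2 D.
Proof.
elim: D E1 E2 => //= e D IH E1 E2 sE [F [sF cF /IH rD]].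
exists F; split=> //; first exact: subset_trans sE.
by apply: rD; apply: setSD.
Qed.

(** The recursion picks the connecting sets one after the other, but disjointness is symmetric, so
    the two sets can be picked in either order. *)
Lemma routable_swap E e f D : routable E (e :: f :: D) -> routable E (f :: e :: D).
Proof.
move=> [F [sF cF [G [sG cG rD]]]].
have /subsetDP [sGE dGF] := sG.
exists G; split=> //; exists F; split=> //.
  by apply/subsetDP; split=> //; rewrite disjoint_sym.
by rewrite setDDl setUC -setDDl.
Qed.

Lemma routable_mid E e D1 D2 :
  routable E (e :: D1 ++ D2) -> routable E (D1 ++ e :: D2).
Proof.
elim: D1 E => // f D1 IH E /routable_swap [F [sF cF /IH rD]].
by exists F.
Qed.

Lemma routable_perm E D1 D2 : perm_eq D1 D2 -> routable E D1 -> routable E D2.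
Proof.
elim: D1 E D2 => [|e D1 IH] E D2; first by move/perm_size; case: D2.
move=> pD [F [sF cF rD]].
have eD2 : e \in D2 by rewrite -(perm_mem pD) mem_head.
case/splitPr: eD2 pD => A B pD.
apply: routable_mid; exists F; split=> //; apply: IH rD.
by rewrite -(perm_cons e) (permPl pD) -[e :: B]cat1s perm_catCA.
Qed.

(** The empty set serves a degenerate demand, so a demand that has shrunk to a single vertex counts
    as served. *)
Lemma routable_loop E x D : routable E D -> routable E ([set x; x] :: D).
Proof.
move=> rD; exists set0; rewrite sub0set setD0; split=> //.
by move=> a b; rewrite !inE !orbb => /eqP-> /eqP->.
Qed.

(** The edge [[set x; z]] is spent on the first step from [x], and the rest of the way is a demand
    from [z]. The reductions below are chains of such moves. *)
Lemma routable_move E x y z D : [set x; z] \in E ->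
  routable (E :\ [set x; z]) ([set z; y] :: D) -> routable E ([set x; y] :: D).
Proof.
move=> xzE [F [sF cF rD]]; exists ([set x; z] |: F); split.
- rewrite subUset sub1set xzE /=; apply: subset_trans sF _; exact: subsetDl.
- have xz : connect (link ([set x; z] |: F)) x z.
    by apply: connect1; rewrite /link !inE eqxx.
  have zy : connect (link ([set x; z] |: F)) z y.
    apply: connect_link_subset (subsetUr _ _) _.
    by apply: cF; rewrite !inE eqxx ?orbT.
  have xy := connect_trans xz zy.
  move=> a b; rewrite !inE => /orP[] /eqP-> /orP[] /eqP-> //.
  by rewrite connect_linkC.
- by rewrite -setDDl.
Qed.

Lemma routable_edge E x y D : [set x; y] \in E ->
  routable (E :\ [set x; y]) D -> routable E ([set x; y] :: D).
Proof. by move=> xyE rD; apply: routable_move xyE _; apply: routable_loop. Qed.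

(** * Edges at a vertex to be eliminated *)

Definition complete S : {set {set V}} := [set e : {set V} | (e \subset S) && (#|e| == 2)].

Lemma complete_pair S x y :
  ([set x; y] \in complete S) = [&& x \in S, y \in S & x != y].
Proof. by rewrite inE subUset !sub1set cards2 -andbA; case: (x == y). Qed.

(* [v] is the vertex being eliminated, and [T] the set of vertices whose edge to
   [v] has not been used yet. *)
Definition spokes S v T : {set {set V}} :=
  [set e : {set V} in complete S | (v \in e) ==> (e \subset v |: T)].

Lemma spokes_complete S v T : spokes S v T \subset complete S.
Proof. by apply/subsetP => e; rewrite inE => /andP[]. Qed.

Lemma spokes_base S v T : complete (S :\ v) \subset spokes S v T.
Proof.
apply/subsetP=> e; rewrite !inE subsetD1 => /andP[/andP[-> /negPf->] ->] //.
Qed.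

(** Spending the edge from [v] to [u] amounts to striking [u] from [T], so a vertex set records what
    is left at [v]. *)
Lemma spokes_use S v T u : u != v -> spokes S v (T :\ u) \subset spokes S v T :\ [set v; u].
Proof.
move=> uv; apply/subsetP=> e; rewrite in_setD1 !in_set.
case: (_ && (_ == 2)); rewrite ?andbF //= => /implyP vT.
apply/andP; split; last first.
  apply/implyP=> /vT /subset_trans; apply; apply: setUS; exact: subsetDl.
apply: contraNneq uv => eE; move: vT; rewrite eE !inE eqxx => /(_ isT) /subsetP.
by move/(_ u); rewrite !inE eqxx orbT orbF => /(_ isT).
Qed.

Lemma spokes_mem S v T u : v \in S -> T \subset S :\ v -> u \in T ->
  [set v; u] \in spokes S v T.
Proof.
move=> vS sT uT; move/subsetP/(_ _ uT): (sT); rewrite !inE => /andP[uv uS].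
rewrite subUset !sub1set vS uS cards2 (eq_sym v) uv /= eqxx /=.
by rewrite subUset !sub1set !inE eqxx uT !orbT.
Qed.

Section Spokes.
Variables (S T : {set V}) (v : V).
Hypotheses (vS : v \in S) (sT : T \subset S :\ v).

Let neq_v u : u \in T -> u != v.
Proof. by move/(subsetP sT); rewrite !inE => /andP[]. Qed.

(** The demand leaves [v] along the edge to [w] and survives as a demand at [w]. The case [w = u]
    serves it completely. *)
Lemma lift_end u w D : w \in T ->
  routable (spokes S v (T :\ w)) ([set w; u] :: D) ->
  routable (spokes S v T) ([set v; u] :: D).
Proof.
move=> wT rD; apply: (@routable_move _ _ _ w); first exact: spokes_mem.
by apply: routable_subset rD; apply: spokes_use; apply: neq_v.
Qed.

Lemma drop_end u D : u \in T -> routable (spokes S v (T :\ u)) D ->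
  routable (spokes S v T) ([set v; u] :: D).
Proof. by move=> uT rD; apply: (lift_end uT); apply: routable_loop. Qed.

End Spokes.

Section SpokesThrough.
Variables (S T : {set V}) (v : V).
Hypotheses (vS : v \in S) (sT : T \subset S :\ v).

(** The demand travels x-v-z, which consumes the two edges at [v] towards [x] and [z]. The case
    [z = y] serves it completely. *)
Lemma lift_through x y z D : x \in T -> z \in T -> x != z ->
  routable (spokes S v (T :\ x :\ z)) ([set z; y] :: D) ->
  routable (spokes S v T) ([set x; y] :: D).
Proof.
move=> xT zT xz rD; have xv : x != v.
  by move/(subsetP sT): xT; rewrite !inE => /andP[].
apply: (@routable_move _ _ _ v); first by rewrite setUC; apply: spokes_mem.
rewrite [[set x; v]]setUC; apply: routable_subset (spokes_use _ _ xv) _.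
apply: (lift_end vS _ (w := z)) => //; last by rewrite !inE eq_sym xz.
by apply: subset_trans sT; apply: subsetDl.
Qed.

Lemma drop_through x y D : x \in T -> y \in T -> x != y ->
  routable (spokes S v (T :\ x :\ y)) D ->
  routable (spokes S v T) ([set x; y] :: D).
Proof. by move=> xT yT xy rD; apply: (lift_through xT yT xy); apply: routable_loop. Qed.

End SpokesThrough.

(** Parallel demands are equal as sets, so connecting sets are attached to indices and disjointness
    is stated for distinct indices. *)
Lemma routable_assign (I : eqType) (g : I -> {set V}) (s : seq I) E :
  uniq s -> routable E (map g s) -> exists P : I -> {set {set V}},
    {in s, forall i, P i \subset E /\ {in g i &, forall x y, connect (link (P i)) x y}}
    /\ {in s &, forall i j, i != j -> [disjoint P i & P j]}.
Proof.
elim: s E => [|i s IH] E /=; first by exists (fun=> set0).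
move=> /andP[i_s /IH{}IH] [F [sF cF /IH [P [cP dP]]]].
have PF j : j \in s -> P j \subset E /\ [disjoint P j & F].
  by move=> /cP [/subsetDP [? ?] _].
have neq j : j \in s -> (j == i) = false by move=> js; apply: contraNF i_s => /eqP<-.
exists (fun j => if j == i then F else P j); split=> [j|j k]; rewrite !inE.
  case: eqP => [-> //|_ /= js]; split; first by case: (PF j js).
  by case: (cP j js).
case: eqP => [->|_] /=; case: eqP => [->|_] /=.
- by rewrite eqxx.
- by move=> _ ks _; rewrite disjoint_sym; case: (PF k ks).
- by move=> js _ _; case: (PF j js).
- exact: dP.
Qed.

End Routing.

(** A walk inside a connecting set shortens to a path without leaving that set, so disjoint
    connecting sets yield edge-disjoint paths. *)
Lemma realizable_of_routable n (D : multigraph 'I_n) :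
  routable (complete [set: 'I_n])
    [seq [set mend1 e; mend2 e] | e <- enum (medge D)] ->
  realizable (complete_graph n) D.
Proof.
move=> /(routable_assign (enum_uniq _)) [P [cP dP]].
have HP e : exists p, is_path (complete_graph n) (mend1 e) (mend2 e) p
                      && (path_edges (mend1 e) p \subset P e).
  case: (cP e (mem_enum _ e)) => sP cPe.
  have /connectP [p0 p0P ->] : connect (link (P e)) (mend1 e) (mend2 e).
    by apply: cPe; rewrite !inE eqxx ?orbT.
  case/shortenP: p0P => p pP pU _; exists p; rewrite /is_path eqxx pU andbT /=.
  apply/andP; split.
    rewrite andbT; apply: (sub_path _ pP) => x y /(subsetP sP).
    by rewrite complete_pair !inE.
  apply/subsetP=> f; rewrite inE => /mapP [[x y] xyp ->] /=.
  elim: p (mend1 e) pP xyp {cPe pU} => //= z p IH w /andP[wz zp].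
  by rewrite inE => /orP[/eqP[-> ->] //|]; apply: IH.
exists (fun e => xchoose (HP e)); split=> [e|e f ef].
  by case/andP: (xchooseP (HP e)).
case/andP: (xchooseP (HP e)) => _ se; case/andP: (xchooseP (HP f)) => _ sf.
by apply: disjointWl se _; apply: disjointWr sf _; apply: dP; rewrite ?mem_enum.
Qed.

(** * Degrees, stars and triangles of demands *)

Section Demands.
Variable V : finType.
Implicit Types (x y z u v w a b : V) (S T U W e f : {set V}) (D : seq {set V}).

Definition deg D x := count (fun e => x \in e) D.

Lemma deg_perm D1 D2 x : perm_eq D1 D2 -> deg D1 x = deg D2 x.
Proof. by move/permP; apply. Qed.

Definition demands S D := all (mem (complete S)) D.

Lemma demands_consP S D e D0 : demands S D -> perm_eq D (e :: D0) ->
  [/\ e \in complete S, demands S D0, size D = (size D0).+1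
    & forall x, deg D x = (x \in e) + deg D0 x].
Proof.
move=> wD pD; move: (wD); rewrite /demands (perm_all _ pD) /= => /andP[eS wD0].
by split=> // [|x]; rewrite ?(perm_size pD) ?(deg_perm _ pD).
Qed.

Lemma deg0P D v : reflect {in D, forall e, v \notin e} (deg D v == 0).
Proof.
rewrite eqn0Ngt -has_count -all_predC; exact: (iffP allP).
Qed.

Lemma demands_isolated S D v : demands S D -> deg D v = 0 -> demands (S :\ v) D.
Proof.
move=> wD /eqP/deg0P vD.
apply/allP=> e eD; move/allP/(_ e eD): wD; rewrite /= !inE => /andP[eS ->].
by rewrite subsetD1 eS vD.
Qed.

Lemma complete_endP S e a : e \in complete S -> a \in e ->
  exists y, [/\ e = [set a; y], y != a & y \in S].
Proof.
rewrite inE => /andP[eS /eqP e2] ae.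
have /cards1P [y ey] : #|e :\ a| == 1 by rewrite -eqSS -e2 (cardsD1 a e) ae.
have : y \in e :\ a by rewrite ey inE.
rewrite !inE => /andP[ya ye]; exists y; split=> //; last exact: (subsetP eS).
by rewrite -(setD1K ae) ey.
Qed.

Lemma complete_pairP S e : e \in complete S ->
  exists x y, [/\ e = [set x; y], x != y, x \in S & y \in S].
Proof.
move=> eS; have /card_gt0P [x xe] : 0 < #|e|.
  by move: eS; rewrite inE => /andP[_ /eqP->].
have [y [-> yx yS]] := complete_endP eS xe.
exists x, y; rewrite eq_sym yx; split=> //.
by move: eS; rewrite inE => /andP[/subsetP/(_ x xe)].
Qed.

Lemma edge_avoiding D u : deg D u < size D -> exists2 e, e \in D & u \notin e.
Proof.
rewrite ltn_neqAle => /andP[]; rewrite -all_count => /allPn [e eD ue] _.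
by exists e.
Qed.

(** If every demand at [a] also contained [u], the degree of [a] could not exceed that of [u]. *)
Lemma edge_at_avoiding S D a u : demands S D -> deg D u < deg D a ->
  exists y D0, [/\ y \in S, y != a, y != u & perm_eq D ([set a; y] :: D0)].
Proof.
move=> wD ltd.
have /hasP [e eD /andP[ae ue]] : has (fun e => (a \in e) && (u \notin e)) D.
  apply: contraLR ltd; rewrite -all_predC -leqNgt => /allP aD.
  rewrite /deg; elim: D aD {wD} => //= e D IH aD.
  rewrite leq_add ?IH // => [|f fD]; last by apply: aD; rewrite inE fD orbT.
  by have := aD e (mem_head _ _); rewrite negb_and negbK; case: (a \in e) => //= ->.
have [y [eE ya yS]] := complete_endP (allP wD e eD) ae.
exists y, (rem e D); rewrite -eE; split=> //; last exact: perm_to_rem.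
by apply: contraNneq ue => <-; rewrite eE !inE eqxx orbT.
Qed.

Lemma edge_at S D a : demands S D -> 0 < deg D a ->
  exists y D0, [/\ y \in S, y != a & perm_eq D ([set a; y] :: D0)].
Proof.
move=> wD; rewrite -has_count => /hasP [e eD ae].
have [y [eE ya yS]] := complete_endP (allP wD e eD) ae.
by exists y, (rem e D); rewrite -eE; split=> //; exact: perm_to_rem.
Qed.

(** Inclusion-exclusion: the demands at [a] and those at [b] are too many to be distinct, so one
    demand contains both vertices. *)
Lemma edge_between S D a b : demands S D -> a != b -> size D < deg D a + deg D b ->
  exists D0, perm_eq D ([set a; b] :: D0).
Proof.
move=> wD ab; rewrite /deg -count_predUI => ltd.
have /hasP [e eD /andP[ae be]] : has (fun e => (a \in e) && (b \in e)) D.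
  rewrite has_count lt0n; apply: contraTneq ltd => /= cD.
  by rewrite -leqNgt [X in _ + X]cD addn0 count_size.
have [y [eE ya yS]] := complete_endP (allP wD e eD) ae.
move: be; rewrite eE !inE eq_sym (negPf ab) => /eqP by_; rewrite by_ -eE.
by exists (rem e D); apply: perm_to_rem.
Qed.

(** Handshake identity: each demand has exactly two endpoints, both in [S]. *)
Lemma deg_sum S D : demands S D -> \sum_(x in S) deg D x = 2 * size D.
Proof.
rewrite /deg; elim: D => [|e D IH] /= => [_|/andP[eS /IH{}IH]]; first by rewrite big1.
rewrite big_split /= IH mulnS; congr (_ + _).
move: eS; rewrite inE => /andP[/subsetP eS /eqP <-].
rewrite (eq_bigr (fun x => if x \in e then 1 else 0)) => [|x _]; last by case: ifP.
rewrite -big_mkcondr sum1_card; apply: eq_card => x.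
by rewrite unfold_in /= andb_idl // => /eS.
Qed.

(** The degree sum is bounded below by [k] on [s] and by [d] elsewhere. This limits the number of
    vertices of large degree in terms of the minimum degree; with [s] empty it bounds the minimum
    degree itself. *)
Lemma deg_count S D d k s : demands S D -> uniq s ->
  all (fun x => (x \in S) && (k <= deg D x)) s ->
  (forall x, x \in S -> d <= deg D x) ->
  k * size s + d * (#|S| - size s) <= 2 * size D.
Proof.
move=> wD us /allP sk dD; rewrite -(deg_sum wD) (bigID (fun x => x \in s)) /=.
have <- : #|[pred x in S | x \in s]| = size s.
  rewrite -(card_uniqP us); apply: eq_card => x; rewrite !inE.
  by apply: andb_idl => /sk /andP[].
have <- : #|[pred x in S | x \notin s]| = #|S| - #|[pred x in S | x \in s]|.
  rewrite -[#|S|](cardID (mem s)) -[X in _ = _ - X](@eq_card _ [predI S & s]) ?addKn //.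
  by apply: eq_card => x; rewrite !inE andbC.
rewrite mulnC [d * _]mulnC -!sum_nat_const; apply: leq_add.
  by apply: leq_sum => x /andP[_ /sk /andP[]].
by apply: leq_sum => x /andP[xS _]; apply: dD.
Qed.

Lemma ex_fresh S (s : seq V) : size s < #|S| -> exists2 z, z \in S & z \notin s.
Proof.
move=> lts; apply/subsetPn; apply: contraL lts => /subset_leq_card.
by rewrite -leqNgt => /leq_trans; apply; apply: card_size.
Qed.

(** * Pairwise intersecting demands *)

Lemma disjoint_pair a b f : [disjoint [set a; b] & f] = (a \notin f) && (b \notin f).
Proof. by rewrite disjoints_subset subUset !sub1set !inE. Qed.

Lemma pair_of_mem S e a b : e \in complete S -> a != b -> a \in e -> b \in e ->
  e = [set a; b].
Proof.
move=> eS ab ae be; have [y [eE ya yS]] := complete_endP eS ae.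
by move: be; rewrite eE !inE eq_sym (negPf ab) => /eqP ->.
Qed.

(** Pairs that meet pairwise form a star or lie on a triangle, and a star is excluded because no
    vertex belongs to all demands. *)
Lemma disjoint_or_triangle S D : demands S D -> 0 < size D ->
  (forall x, x \in S -> deg D x < size D) ->
  (exists e f, [/\ e \in D, f \in D & [disjoint e & f]]) \/
  (exists x y z, [/\ uniq [:: x; y; z], {subset [:: x; y; z] <= S},
     {subset [:: [set x; y]; [set y; z]; [set x; z]] <= D}
     & {subset D <= [:: [set x; y]; [set y; z]; [set x; z]]}]).
Proof.
move=> wD D0 dD.
have [/hasP [e eD /hasP [f fD ef]]|] :=
  boolP (has (fun e => has (fun f : {set V} => [disjoint e & f]) D) D).
  by left; exists e, f.
move=> noD; right.
have meet e f : e \in D -> f \in D -> ~~ [disjoint e & f].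
  move=> eD fD; apply: contra noD => ef.
  by apply/hasP; exists e => //; apply/hasP; exists f.
have DS e : e \in D -> e \in complete S by move/(allP wD).
have [e eD] : exists e, e \in D by case: D D0 {wD dD noD meet DS} => // e D; exists e; apply: mem_head.
have [x [y [eE xy xS yS]]] := complete_pairP (DS e eD).
(* Since [f] misses [x], [g] misses [y], and both meet [e] and each other, the three demands are the
   sides of a triangle. *)
have [f fD xf] := edge_avoiding (dD x xS).
have [g gD yg] := edge_avoiding (dD y yS).
have yf : y \in f by have := meet e f eD fD; rewrite eE disjoint_pair xf /= negbK.
have [z [fE zy zS]] := complete_endP (DS f fD) yf.
have xz : x != z by apply: contraNneq xf => ->; rewrite fE !inE eqxx orbT.
have xg : x \in g by have := meet e g eD gD; rewrite eE disjoint_pair yg andbT negbK.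
have zg : z \in g by have := meet f g fD gD; rewrite fE disjoint_pair yg negbK.
have gE := pair_of_mem (DS g gD) xz xg zg.
exists x, y, z; rewrite -eE -fE -gE; split.
- by rewrite /= !inE negb_or xy xz eq_sym zy.
- by move=> t; rewrite !inE => /or3P[] /eqP->.
- by move=> t; rewrite !inE => /or3P[] /eqP->.
(* A demand that meets all three sides contains two of the three corners, hence is a side itself. *)
move=> h hD; have hS := DS h hD; have yz : y != z by rewrite eq_sym.
have := meet e h eD hD; have := meet f h fD hD; have := meet g h gD hD.
rewrite eE fE gE !disjoint_pair !negb_and !negbK => /orP[] h1 /orP[] h2 /orP[] h3;
  rewrite !inE;
  by [ rewrite (pair_of_mem hS xy) ?eqxx ?orbT
     | rewrite (pair_of_mem hS yz) ?eqxx ?orbT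
     | rewrite (pair_of_mem hS xz) ?eqxx ?orbT ].
Qed.

(** * Demands confined to a triangle *)

Lemma perm_nseq3 D e1 e2 e3 : uniq [:: e1; e2; e3] ->
  {subset D <= [:: e1; e2; e3]} ->
  perm_eq D (nseq (count_mem e1 D) e1 ++ nseq (count_mem e2 D) e2
               ++ nseq (count_mem e3 D) e3).
Proof.
rewrite /= !inE negb_or andbT => /andP[/andP[/negPf n12 /negPf n13] /negPf n23] sD.
apply/permP=> a; rewrite !count_cat !count_nseq.
elim: D sD => [|e D IH] sD /=; first by rewrite !muln0.
rewrite IH => [|f fD]; last by apply: sD; rewrite inE fD orbT.
have /or3P[] : [|| e == e1, e == e2 | e == e3].
- by have := sD e (mem_head _ _); rewrite !inE.
- by move/eqP->; rewrite eqxx n12 n13; lia.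
- by move/eqP->; rewrite eqxx eq_sym n12 n23; lia.
- by move/eqP->; rewrite eqxx eq_sym n13 eq_sym n23; lia.
Qed.

Lemma perm_nseqS3 e1 e2 e3 p q r :
  perm_eq (e1 :: e2 :: e3 :: nseq p e1 ++ nseq q e2 ++ nseq r e3)
          (nseq p.+1 e1 ++ nseq q.+1 e2 ++ nseq r.+1 e3).
Proof.
apply/permP=> P; rewrite /= !count_cat /= !count_cat /=.
move: (count P (nseq p _)) (count P (nseq q _)) (count P (nseq r _)) => i j k.
by move: (nat_of_bool (P e1)) (nat_of_bool (P e2)) (nat_of_bool (P e3)); lia.
Qed.

(** For disjoint [U] and [W] this is the complete graph on their union without the edges inside [W]:
    it models what remains for demands on a triangle [W] once its own sides are spent. *)
Definition brim U W : {set {set V}} := [set e in complete (U :|: W) | ~~ (e \subset W)].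

Lemma brim_pair U W u w : u \in U -> u \notin W -> w \in U :|: W -> u != w ->
  [set u; w] \in brim U W.
Proof.
move=> uU uW wUW uw; rewrite inE complete_pair wUW uw !inE uU /=.
by rewrite subUset sub1set (negPf uW).
Qed.

Lemma brim_notin U W u e : u \notin W -> u \in e -> e \notin brim (U :\ u) W.
Proof.
move=> uW ue; rewrite !inE; apply/negP => /andP[/andP[/subsetP/(_ u ue)]].
by rewrite !inE eqxx (negPf uW).
Qed.

Lemma brimS U1 U2 W : U1 \subset U2 -> brim U1 W \subset brim U2 W.
Proof.
move=> sU; apply/subsetP=> e; rewrite !inE => /andP[/andP[eU ->] ->]; rewrite !andbT.
by apply: subset_trans eU _; apply: setSU.
Qed.

Lemma eq_pair a b c d :
  ([set a; b] == [set c; d]) = (a == c) && (b == d) || (a == d) && (b == c).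
Proof.
apply/idP/idP => [/eqP E|/orP[] /andP[/eqP-> /eqP->] //]; last by rewrite setUC.
have := set21 a b; have := set22 a b; rewrite E !inE.
have := set21 c d; have := set22 c d; rewrite -E !inE ![c == _]eq_sym ![d == _]eq_sym.
by do 4![case/orP => /eqP ?]; subst; rewrite ?eqxx ?orbT.
Qed.

(** Each demand from the centre [c] to some [t] takes a private vertex [u] of [U] and runs c-u-t. *)
Lemma routable_star U W c D : [disjoint U & W] -> size D <= #|U| ->
  c \in W -> demands W D -> (forall e, e \in D -> c \in e) ->
  routable (brim U W) D.
Proof.
move=> dUW sD cW; elim: D U dUW sD => //= e D IH U dUW sD /andP[eW wD] cD.
have /card_gt0P [u uU] : 0 < #|U| by apply: leq_trans sD.
have uW : u \notin W by rewrite (disjointFr dUW).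
have [t [eE tc tW]] := complete_endP eW (cD e (mem_head _ _)).
have nu w : w \in W -> u != w by move=> wW; apply: contraNneq uW => ->.
have WU w : w \in W -> w \in U :|: W by move=> wW; rewrite inE wW orbT.
rewrite eE; apply: (@routable_move _ _ _ _ u).
  by rewrite setUC brim_pair ?nu ?WU.
apply: routable_edge.
  by rewrite in_setD1 brim_pair ?nu ?WU // eq_pair (negPf (nu c cW)) (negPf tc) andbF.
apply: (@routable_subset _ (brim (U :\ u) W)).
  by rewrite !subsetD1 !brim_notin ?inE ?eqxx ?orbT // brimS // subD1set.
apply: IH => // [||f fD].
- by apply: disjointWl dUW; apply: subD1set.
- by rewrite (cardsD1 u U) uU in sD.
- by apply: cD; rewrite inE fD orbT.
Qed.

(** Induction on [p]. If one kind of demand is exhausted, the other two share a corner and form a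
    star. Otherwise one demand of each kind is served at the cost of two vertices of [U], which
    lowers each pairwise sum by two as well. *)
Lemma routable_triangle_brim U x y z p q r :
  uniq [:: x; y; z] -> [disjoint U & [set x; y; z]] ->
  p + q <= #|U| -> q + r <= #|U| -> p + r <= #|U| ->
  routable (brim U [set x; y; z])
    (nseq p [set x; y] ++ nseq q [set y; z] ++ nseq r [set x; z]).
Proof.
rewrite /= !inE negb_or andbT => /andP[/andP[xy xz] yz].
set W := [set x; y; z].
have xW : x \in W by rewrite !inE eqxx.
have yW : y \in W by rewrite !inE eqxx orbT.
have zW : z \in W by rewrite !inE eqxx orbT.
have starW c t : c \in W -> t \in W -> c != t -> [set c; t] \in complete W.
  by move=> cW tW ct; rewrite complete_pair cW tW.
elim: p q r U => [|p IH] q r U dUW pq qr pr.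
  apply: (@routable_star _ _ z) => //; first by rewrite !size_cat !size_nseq.
    by rewrite /demands !all_cat !all_nseq /= !starW ?orbT.
  by move=> e; rewrite !mem_cat !mem_nseq => /or3P[] /andP[] // _ /eqP->; rewrite !inE eqxx orbT.
case: q pq qr => [|q] pq qr.
  apply: (@routable_star _ _ x) => //; first by rewrite !size_cat !size_nseq.
    by rewrite /demands !all_cat !all_nseq /= !starW ?orbT.
  by move=> e; rewrite !mem_cat !mem_nseq => /or3P[] /andP[] // _ /eqP->; rewrite !inE eqxx.
case: r pr qr => [|r] pr qr.
  apply: (@routable_star _ _ y) => //; first by rewrite !size_cat !size_nseq addn0.
    by rewrite /demands !all_cat !all_nseq /= !starW ?orbT.
  move=> e; rewrite !mem_cat !mem_nseq => /or3P[] /andP[] // _ /eqP->;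
    by rewrite !inE eqxx ?orbT.
(* Two vertices [u], [v] outside the triangle serve one demand of each kind,
   along x-u-y, y-v-z and x-v-u-z. *)
have [u uU _] : exists2 u, u \in U & u \notin [::] by apply: ex_fresh => /=; lia.
have [v vU] : exists2 v, v \in U & v \notin [:: u] by apply: ex_fresh => /=; lia.
rewrite inE => vu.
have uW : u \notin W by rewrite (disjointFr dUW).
have vW : v \notin W by rewrite (disjointFr dUW).
have [ux uy uz] : [/\ u != x, u != y & u != z] by move: uW; rewrite !inE !negb_or => /andP[/andP[]].
have [vx vy vz] : [/\ v != x, v != y & v != z] by move: vW; rewrite !inE !negb_or => /andP[/andP[]].
apply: (@routable_perm _ _ ([set x; y] :: [set y; z] :: [set x; z] ::
    nseq p [set x; y] ++ nseq q [set y; z] ++ nseq r [set x; z])).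
  exact: perm_nseqS3.
have neqs := (negPf xy, negPf xz, negPf yz, negPf vu, negPf ux, negPf uy,
  negPf uz, negPf vx, negPf vy, negPf vz).
have neqs' : (((y == x) = false) * ((z == x) = false) * ((z == y) = false) *
  ((u == v) = false) * ((x == u) = false) * ((y == u) = false) * ((z == u) = false) *
  ((x == v) = false) * ((y == v) = false) * ((z == v) = false))%type.
  by do !split; rewrite eq_sym neqs.
have bu w : w \in U :|: W -> w != u -> [set w; u] \in brim U W.
  by move=> wUW wu; rewrite setUC brim_pair // eq_sym.
have bv w : w \in U :|: W -> w != v -> [set w; v] \in brim U W.
  by move=> wUW wv; rewrite setUC brim_pair // eq_sym.
have UW w : w \in W -> w \in U :|: W by move=> wW; rewrite inE wW orbT.
apply: (@routable_move _ _ _ _ u).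
  by rewrite bu ?UW ?neqs'.
apply: routable_edge.
  by rewrite in_setD1 eq_pair !(neqs, neqs') !andbF setUC bu ?UW ?neqs'.
apply: (@routable_move _ _ _ _ v).
  by rewrite !in_setD1 !eq_pair !(neqs, neqs') ?andbF bv ?UW ?neqs'.
apply: routable_edge.
  by rewrite !in_setD1 !eq_pair !(neqs, neqs', andbF) setUC bv ?UW ?neqs'.
apply: (@routable_move _ _ _ _ v).
  by rewrite !in_setD1 !eq_pair !(neqs, neqs', andbF) bv ?UW ?neqs'.
apply: (@routable_move _ _ _ _ u).
  by rewrite !in_setD1 !eq_pair !(neqs, neqs', andbF) bu ?inE ?vU ?neqs.
apply: routable_edge.
  by rewrite !in_setD1 !eq_pair !(neqs, neqs', andbF) setUC bu ?UW ?neqs'.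
apply: (@routable_subset _ (brim (U :\ u :\ v) W)).
  have nu e : u \in e -> e \notin brim (U :\ u :\ v) W.
    by move=> ue; rewrite setDDl setUC -setDDl brim_notin.
  have nv e : v \in e -> e \notin brim (U :\ u :\ v) W by move=> ve; rewrite brim_notin.
  have sUU : U :\ u :\ v \subset U by apply: subset_trans (subD1set _ _) (subD1set _ _).
  rewrite !subsetD1 brimS //= ?(nu [set x; u], nu [set u; y], nu [set v; u],
    nu [set u; z], nv [set y; v], nv [set v; z], nv [set x; v]) ?set21 ?set22 //.
have cU : #|U| = #|U :\ u :\ v|.+2 by rewrite (cardsD1 u U) uU (cardsD1 v (U :\ u)) !inE vu vU.
apply: IH.
- by apply: disjointWl dUW; apply: subset_trans (subD1set _ _) (subD1set _ _).
- by move: pq; rewrite cU addSn addnS !ltnS.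
- by move: qr; rewrite cU addSn addnS !ltnS.
- by move: pr; rewrite cU addSn addnS !ltnS.
Qed.

(** Each side first carries one of its own demands. A corner then has two fewer demands, and since
    [S] has three vertices more than [U], its degree bound becomes exactly the bound on a pairwise
    sum in [routable_triangle_brim]. *)
Lemma routable_triangle S D x y z : uniq [:: x; y; z] -> {subset [:: x; y; z] <= S} ->
  {subset [:: [set x; y]; [set y; z]; [set x; z]] <= D} ->
  {subset D <= [:: [set x; y]; [set y; z]; [set x; z]]} ->
  (forall x, x \in S -> deg D x < #|S|) -> routable (complete S) D.
Proof.
move=> uxyz xyzS tD Dt dD.
move: (uxyz); rewrite /= !inE negb_or andbT => /andP[/andP[xy xz] yz].
have neqs := (negPf xy, negPf xz, negPf yz).
have neqs' : (((y == x) = false) * ((z == x) = false) * ((z == y) = false))%type.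
  by do !split; rewrite eq_sym neqs.
have [xS yS zS] : [/\ x \in S, y \in S & z \in S].
  by split; apply: xyzS; rewrite !inE eqxx ?orbT.
have uD : uniq [:: [set x; y]; [set y; z]; [set x; z]].
  by rewrite /= !inE !eq_pair !(eqxx, neqs, neqs').
have := perm_nseq3 uD Dt.
have pos e : e \in [:: [set x; y]; [set y; z]; [set x; z]] -> 0 < count_mem e D.
  by move=> /tD; rewrite -has_count has_pred1.
have [pxy pyz pxz] : [/\ 0 < count_mem [set x; y] D,
    0 < count_mem [set y; z] D & 0 < count_mem [set x; z] D].
  by split; apply: pos; rewrite !inE eqxx ?orbT.
case: (count_mem [set x; y] D) pxy => // p _; case: (count_mem [set y; z] D) pyz => // q _.
case: (count_mem [set x; z] D) pxz => // r _ pD.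
have cS : #|S| = #|S :\: [set x; y; z]| + 3.
  rewrite -(cardsID [set x; y; z] S) addnC; congr (_ + _).
  have /setIidPr -> : [set x; y; z] \subset S by rewrite !subUset !sub1set xS yS.
  by rewrite setUC cardsU1 cards2 !inE !(neqs, neqs').
have := dD x xS; have := dD y yS; have := dD z zS.
rewrite !(deg_perm _ pD) /deg !(count_cat, count_nseq) /= !inE !(eqxx, neqs, neqs') cS /= => dz dy dx.
apply: (@routable_perm _ _ ([set x; y] :: [set y; z] :: [set x; z] ::
    nseq p [set x; y] ++ nseq q [set y; z] ++ nseq r [set x; z])).
  by rewrite perm_sym; apply: perm_trans pD _; rewrite perm_sym perm_nseqS3.
apply: routable_edge; first by rewrite complete_pair xS yS.
apply: routable_edge.
  by rewrite in_setD1 complete_pair eq_pair yS zS yz !(neqs, neqs', andbF).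
apply: routable_edge.
  by rewrite !in_setD1 complete_pair !eq_pair xS zS xz !(neqs, neqs', andbF).
apply: routable_subset; last first.
  apply: (@routable_triangle_brim (S :\: [set x; y; z])) => //; try (clear -dx dy dz; lia).
  by rewrite disjoint_sym disjoints_subset setCD subsetUr.
rewrite !subsetD1 -!andbA; apply/and4P; split.
- apply/subsetP => e; rewrite !inE => /andP[/andP[eS ->] _]; rewrite andbT.
  apply: subset_trans eS _; rewrite subUset subsetDl /=.
  by rewrite !subUset !sub1set xS yS.
all: by rewrite !inE !subUset !sub1set !inE !eqxx ?orbT ?andbF.
Qed.

(** * Eliminating a vertex *)

Section RemoveVertex.
Variables (S : {set V}) (D : seq {set V}) (v : V).
Hypotheses (vS : v \in S) (wD : demands S D).
Hypotheses (n5 : 5 <= #|S|) (mD : size D + 5 = 2 * #|S|).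
Hypothesis dD : forall x, x \in S -> deg D x < #|S|.
Hypothesis IH : forall D', demands (S :\ v) D' -> size D' + 5 <= 2 * (#|S| - 1) ->
  (forall x, x \in S :\ v -> deg D' x < #|S| - 1) -> routable (complete (S :\ v)) D'.

(** By [mD], the size bound says that at least two demands have been served on the way from [D] to
    [D']; the edges still free at [v] are then abandoned. *)
Let finish T D' : demands S D' -> deg D' v = 0 -> size D' + 7 <= 2 * #|S| ->
  (forall x, x \in S -> x != v -> deg D' x < #|S| - 1) -> routable (spokes S v T) D'.
Proof.
move=> wD' vD' sD' dD'; apply: routable_subset (spokes_base _ _ _) _; apply: IH.
- exact: demands_isolated.
- lia.
- by move=> x; rewrite !inE => /andP[xv xS]; apply: dD'.
Qed.

Let start D' : perm_eq D D' -> routable (spokes S v (S :\ v)) D' -> routable (complete S) D.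
Proof.
move=> pD rD'; apply: routable_perm; first by rewrite perm_sym; exact: pD.
exact: routable_subset (spokes_complete _ _ _) rD'.
Qed.

Let sT (T : {set V}) a : T \subset S :\ v -> T :\ a \subset S :\ v.
Proof. exact: subset_trans (subD1set _ _). Qed.

(** Four such vertices would contribute at least [4 * #|S| - 8] to a degree sum of
    [4 * #|S| - 10]. *)
Let few_high s : uniq s ->
  all (fun x => (x \in S) && (#|S| - 2 <= deg D x)) s -> size s <= 3.
Proof.
move=> us hs; have := deg_count wD us hs (fun x _ => leq0n (deg D x)).
by case: (leqP (size s) 3) => // s4; nia.
Qed.

(** Both demands run through [v] on four different edges, and each vertex of maximal degree loses
    one of them. *)
Lemma remove_isolated_disjoint e f : deg D v = 0 -> e \in D -> f \in D ->
  [disjoint e & f] ->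
  (forall x, x \in S -> #|S| - 1 <= deg D x -> (x \in e) || (x \in f)) ->
  routable (complete S) D.
Proof.
move=> dv eD fD ef cov.
have [a [b [eE ab aS bS]]] := complete_pairP (allP wD e eD).
have [c [d [fE cd cS dS]]] := complete_pairP (allP wD f fD).
have fe : f != e.
  by apply: contraTneq ef => ->; rewrite eE disjoint_pair !inE eqxx.
have pD : perm_eq D (e :: f :: rem f (rem e D)).
  apply: perm_trans (perm_to_rem eD) _; rewrite perm_cons; apply: perm_to_rem.
  by have := perm_mem (perm_to_rem eD) f; rewrite fD inE (negPf fe) => /esym.
move: (rem f (rem e D)) pD => D2 pD.
have [_ wD1 sD1 dD1] := demands_consP wD pD.
have [_ wD2 sD2 dD2] := demands_consP wD1 (perm_refl _).
move/eqP/deg0P: (dv) => vD.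
have [va vb] : a != v /\ b != v.
  by move: (vD e eD); rewrite eE !inE negb_or ![v == _]eq_sym => /andP.
have [vc vd] : c != v /\ d != v.
  by move: (vD f fD); rewrite fE !inE negb_or ![v == _]eq_sym => /andP.
move: ef; rewrite eE fE disjoint_pair !inE !negb_or => /andP[/andP[ac ad] /andP[bc bd]].
apply: (start pD); rewrite eE fE.
apply: drop_through => //; rewrite ?inE ?va ?vb //.
apply: drop_through => //; rewrite ?inE ?vc ?vd ?[c == _]eq_sym ?[d == _]eq_sym ?ac ?bc ?ad ?bd //.
  by do 2!apply: sT.
apply: finish => //.
- by move: (dD1 v) (dD2 v); rewrite dv; clear; lia.
- by move: sD1 sD2 mD; clear; rewrite /=; lia.
move=> x xS xv; move: (dD1 x) (dD2 x) (dD xS) (cov x xS).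
by case: (x \in e); case: (x \in f); clear; rewrite /=; lia.
Qed.

(* Serve [ab] and [f] through [v]; the third vertex [c] of degree n - 1 is relieved
   by turning a demand [ca] into [za]. *)
Lemma remove_isolated_lift a b c f : deg D v = 0 -> f \in D ->
  uniq [:: a; b; c] -> {subset [:: a; b; c] <= S} ->
  (forall x, x \in [:: a; b; c] -> #|S| - 1 <= deg D x) ->
  [disjoint [set a; b] & f] -> c \notin f -> routable (complete S) D.
Proof.
move=> dv fD uabc abcS habc; rewrite disjoint_pair => /andP[af bf] cf.
have [abP aS bS cS] : [/\ forall x, x \in [:: a; b; c] -> x \in S, a \in S, b \in S & c \in S].
  by split=> //; apply: abcS; rewrite !inE eqxx ?orbT.
have high x : x \in [:: a; b; c] -> (x \in S) && (#|S| - 2 <= deg D x).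
  move=> xabc; rewrite abcS //=; apply: leq_trans (habc x xabc); exact: leq_sub2l.
(* A fourth vertex of degree at least [#|S| - 2] is impossible, so any other vertex can take on one
   more demand. *)
have low w : w \in S -> w \notin [:: a; b; c] -> deg D w + 2 < #|S|.
  move=> wS wabc; rewrite ltnNge; apply/negP => dw.
  have us : uniq (w :: [:: a; b; c]) by rewrite cons_uniq wabc.
  suff hs : all (fun t => (t \in S) && (#|S| - 2 <= deg D t)) (w :: [:: a; b; c]).
    by have := few_high us hs.
  by apply/allP => t; rewrite inE => /predU1P[->|/high//]; rewrite wS leq_subLR addnC.
(* Three degrees of at least [#|S| - 1] in a sum of [4 * #|S| - 10] force seven vertices, which
   leaves room for [z] outside the six named ones. *)
have n7 : 7 <= #|S|.
  have h3 : all (fun x => (x \in S) && (#|S| - 1 <= deg D x)) [:: a; b; c].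
    by apply/allP => x xabc; rewrite abcS // habc.
  move: (deg_count wD uabc h3 (fun x _ => leq0n (deg D x))) mD.
  by clear; rewrite /=; lia.
move: uabc; rewrite /= !inE negb_or andbT => /andP[/andP[ab ac] bc].
have [da db dc] : [/\ #|S| - 1 <= deg D a, #|S| - 1 <= deg D b & #|S| - 1 <= deg D c].
  by split; apply: habc; rewrite !inE eqxx ?orbT.
have [|D1 pD1] := edge_between wD ab; first by move: da db mD n5; clear; lia.
have [_ wD1 sD1 dD1] := demands_consP wD pD1.
have fab : f != [set a; b] by apply: contraNneq af => ->; rewrite set21.
have fD1 : f \in D1 by move: fD; rewrite (perm_mem pD1) inE (negPf fab).
have [x [y [fE xy xS yS]]] := complete_pairP (allP wD f fD).
have pD2 := perm_to_rem fD1; have [_ wD2 sD2 dD2] := demands_consP wD1 pD2.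
set D2 := rem f D1 in pD2 wD2 sD2 dD2.
move: af bf cf; rewrite fE !inE !negb_or => /andP[ax ay] /andP[bx by_] /andP[cx cy].
rewrite fE in pD2 dD2.
have ca : c != a by rewrite eq_sym.
have [|D3 pD3] := edge_between wD2 ca.
  move: (dD1 a) (dD1 c) (dD2 a) (dD2 c).
  rewrite !inE eqxx (negPf ca) [c == b]eq_sym (negPf bc) (negPf ax) (negPf ay) (negPf cx) (negPf cy) /=.
  by move: da dc sD1 sD2 mD; clear; lia.
have [_ wD3 sD3 dD3] := demands_consP wD2 pD3.
have [|z zS] := ex_fresh (S := S) (s := [:: a; b; c; x; y; v]); first exact: n7.
rewrite !inE !negb_or => /and5P[za zb zc zx /andP[zy zv]].
have vD : {in D, forall e, v \notin e} by apply/deg0P/eqP.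
have mem_v t g : g \in D -> t \in g -> t != v.
  by move=> gD tg; apply: contraTneq tg => ->; apply: vD.
have pD : perm_eq D [:: [set a; b], [set x; y], [set c; a] & D3].
  apply: perm_trans pD1 _; rewrite perm_cons; apply: perm_trans pD2 _.
  by rewrite perm_cons.
have [av bv] : a != v /\ b != v.
  by split; apply: (mem_v _ [set a; b]); rewrite ?(perm_mem pD) ?inE eqxx ?orbT.
have [xv yv] : x != v /\ y != v.
  by split; apply: (mem_v _ [set x; y]); rewrite ?(perm_mem pD) ?inE eqxx ?orbT.
have cv : c != v.
  by apply: (mem_v _ [set c; a]); rewrite ?(perm_mem pD) ?inE eqxx ?orbT.
apply: (start pD); apply: drop_through; rewrite ?inE ?av ?bv //.
apply: drop_through; rewrite ?inE ?xv ?yv ?xS ?yS ?[x == _]eq_sym ?[y == _]eq_sym ?ax ?ay ?bx ?by_ //.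
  by do 2!apply: sT.
(* The edge from [v] to [a] already serves [[set a; b]], so the demand between [c] and [a] cannot be
   finished through [v]. Moving its end [c] to [z] relieves [c], while [a] has already lost a
   demand. *)
apply: (@lift_through _ _ _ _ vS _ _ _ z); rewrite ?inE ?cv ?zv ?cS ?zS ?ca ?cx ?cy ?za ?zb ?zx ?zy ?[c == _]eq_sym ?zc ?bc //.
  by do 4!apply: sT.
apply: finish.
- by rewrite /demands /= complete_pair zS aS za.
- move: (dD1 v) (dD2 v) (dD3 v); rewrite dv [deg (_ :: _) v]/= !inE ![v == _]eq_sym.
  by rewrite (negPf zv) (negPf av); clear; lia.
- by move: mD sD1 sD2 sD3; clear; rewrite /=; lia.
move=> w wS wv; move: (dD1 w) (dD2 w) (dD3 w) (dD wS) (low w wS).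
rewrite [deg (_ :: _) w]/= !inE !negb_or.
have [->|_] := eqVneq w z.
  by rewrite (negPf za) (negPf zb) (negPf zc) (negPf zx) (negPf zy); clear; rewrite /=; lia.
by case: ((w == x) || (w == y)); case: (w == a); case: (w == b); case: (w == c);
  clear; rewrite /=; lia.
Qed.

(** Outside the triangle case there are two disjoint demands; they are exchanged until they cover
    the vertices of maximal degree, collected in [H]. The exchange can fail only for a third such
    vertex, when the first two share a demand. *)
Lemma remove_isolated : deg D v = 0 -> routable (complete S) D.
Proof.
move=> dv.
have [|x xS|[e [f [eD fD ef]]]|[x [y [z [uxyz xyzS tD Dt]]]]] := disjoint_or_triangle wD.
- by move: mD n5; clear; lia.
- by move: (dD xS) mD n5; clear; lia.
2: exact: routable_triangle uxyz xyzS tD Dt dD.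
pose H x := (x \in S) && (#|S| - 1 <= deg D x).
(* If [p] is uncovered, take any demand at [p]: its other end lies in at most one of [e] and [f], so
   the other one stays disjoint from it. *)
have cover p : H p -> exists e f, [/\ e \in D, f \in D, [disjoint e & f] & p \in e].
  move=> /andP[pS dp].
  have [pe|pe] := boolP (p \in e); first by exists e, f.
  have [pf|pf] := boolP (p \in f); first by exists f, e; rewrite disjoint_sym.
  have [|y [D0 [yS yp yv pD]]] := edge_at_avoiding (a := p) (u := v) wD; first by move: dv dp n5; clear; lia.
  have gD : [set p; y] \in D by rewrite (perm_mem pD) mem_head.
  have [ye|ye] := boolP (y \in e).
    by exists [set p; y], f; rewrite disjoint_pair pf (disjointFr ef ye) set21.
  by exists [set p; y], e; rewrite disjoint_pair pe ye set21.
(* Two degrees of at least [#|S| - 1] exceed the number [2 * #|S| - 5] of demands. *)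
have edgeH p q : H p -> H q -> p != q -> [set p; q] \in D.
  move=> /andP[pS dp] /andP[qS dq] pq.
  have [|D0 pD] := edge_between wD pq; first by move: dp dq mD n5; clear; lia.
  by rewrite (perm_mem pD) mem_head.
case: (pickP H) => [a Ha|noH]; last first.
  apply: (remove_isolated_disjoint dv eD fD ef) => x xS dx.
  by have := noH x; rewrite /H xS dx.
have aS : a \in S by case/andP: Ha.
case: (pickP (fun x => H x && (x != a))) => [b /andP[Hb ba]|noH2]; last first.
  have [{}e [{}f [{}eD {}fD {}ef ae]]] := cover a Ha.
  apply: (remove_isolated_disjoint dv eD fD ef) => x xS dx.
  by have := noH2 x; rewrite /H xS dx /= => /negbFE/eqP->; rewrite ae.
have bS : b \in S by case/andP: Hb.
have {cover} [{}e [{}f [{}eD {}fD {}ef ae bef]]] : exists e f,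
    [/\ e \in D, f \in D, [disjoint e & f], a \in e & (b \in e) || (b \in f)].
  have [e1 [f1 [e1D f1D e1f1 ae1]]] := cover a Ha.
  have [be1|be1] := boolP (b \in e1); first by exists e1, f1; rewrite be1.
  have [bf1|bf1] := boolP (b \in f1); first by exists e1, f1; rewrite bf1 orbT.
  exists [set a; b], f1; rewrite edgeH 1?eq_sym // disjoint_pair bf1.
  by rewrite (disjointFr e1f1 ae1) set21 set22.
case: (pickP (fun x => H x && (x \notin e :|: f))) => [c /andP[Hc]|noH3]; last first.
  apply: (remove_isolated_disjoint dv eD fD ef) => x xS dx.
  by have := noH3 x; rewrite /H xS dx /= => /negbFE; rewrite inE.
rewrite inE negb_or => /andP[ce cf].
have cS : c \in S by case/andP: Hc.
have ca : c != a by apply: contraNneq ce => ->.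
have af : a \notin f by rewrite (disjointFr ef ae).
have [be|be] := boolP (b \in e).
  have bf : b \notin f by rewrite (disjointFr ef be).
  have cb : c != b by apply: contraNneq ce => ->.
  apply: (@remove_isolated_lift a b c f) => //.
  - by rewrite /= !inE negb_or eq_sym ba eq_sym ca eq_sym cb.
  - by move=> x; rewrite !inE => /or3P[] /eqP->.
  - by move=> x; rewrite !inE => /or3P[] /eqP->; [case/andP: Ha|case/andP: Hb|case/andP: Hc].
  - by rewrite disjoint_pair af bf.
have bf : b \in f by move: bef; rewrite (negPf be).
have cb : c != b by apply: contraNneq cf => ->.
(* Replacing [e] by the demand between [a] and [c] covers [a], [b] and [c]; a further uncovered
   vertex of [H] would contradict [few_high]. *)
have acf : [disjoint [set a; c] & f] by rewrite disjoint_pair af cf.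
have acD : [set a; c] \in D by rewrite edgeH 1?eq_sym.
apply: (remove_isolated_disjoint dv acD fD acf) => x xS dx.
apply: contraT; rewrite !inE !negb_or => /andP[/andP[xa xc] xf].
have xb : x != b by apply: contraNneq xf => ->.
have := few_high (s := [:: x; a; b; c]); rewrite /= !inE !negb_or.
rewrite xa xb xc eq_sym ba eq_sym ca eq_sym cb xS aS bS cS /=.
case/andP: Ha => _ da; case/andP: Hb => _ db; case/andP: Hc => _ dc.
have le y : #|S| - 1 <= deg D y -> #|S| - 2 <= deg D y by apply: leq_trans; apply: leq_sub2l.
by rewrite !le // => /(_ isT isT).
Qed.

(** The demand at [v] takes its own edge, which relieves [u]. One more demand, avoiding [u], goes
    through [v] and has to cover the other vertices of maximal degree, of which there are at most
    two. *)
Lemma remove_degree1 : deg D v = 1 -> (forall x, x \in S -> 1 <= deg D x) ->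
  routable (complete S) D.
Proof.
move=> dv posD; have [|u [D0 [uS uv pD0]]] := edge_at (a := v) wD; first by rewrite dv.
have [_ wD0 sD0 dD0] := demands_consP wD pD0.
have vu : v != u by rewrite eq_sym.
pose H x := [&& x \in S, x != u & #|S| - 1 <= deg D x].
have D0v : deg D0 v = 0 by move: (dD0 v); rewrite dv set21; clear; lia.
have D0u : deg D0 u < #|S| - 1 by move: (dD0 u) (dD uS) n5; rewrite set22; clear; lia.
have D0H x : H x -> #|S| - 1 <= deg D0 x.
  case/and3P=> xS xu dx; have xv : x != v.
    by apply: contraTneq dx => ->; rewrite dv; move: n5; clear; lia.
  by move: (dD0 x) dx; rewrite !inE (negPf xu) (negPf xv) => ->.
suff [x [y [D1 [xu yu pD1 cov]]]] : exists x y D1, [/\ x != u, y != u,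
    perm_eq D0 ([set x; y] :: D1) & forall w, H w -> w \in [set x; y]].
  have [xyS wD1 sD1 dD1] := demands_consP wD0 pD1.
  move: xyS; rewrite complete_pair => /and3P[xS yS xy].
  move: (dD1 v); rewrite D0v !inE => /esym/eqP.
  rewrite addn_eq0 eqb0 negb_or ![v == _]eq_sym => /andP[/andP[xv yv] /eqP D1v].
  have pD : perm_eq D [:: [set v; u], [set x; y] & D1].
    by apply: perm_trans pD0 _; rewrite perm_cons.
  apply: (start pD); apply: drop_end; rewrite ?inE ?uv //.
  apply: drop_through; rewrite ?inE ?xu ?yu ?xv ?yv //; first exact: sT.
  apply: finish => //; first by move: mD sD0 sD1; clear; lia.
  move=> w wS wv; move: (dD0 w) (dD1 w) (dD wS) (cov w); rewrite /H wS !inE (negPf wv).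
  by case: ((w == x) || (w == y)); case: (w == u); clear; rewrite /=; lia.
(* Even without the demand at [v], two vertices of [H] have more demands than [D0] contains, hence
   share one. *)
have two a b : H a -> H b -> a != b -> exists D1, perm_eq D0 ([set a; b] :: D1).
  move=> /D0H da /D0H db ab; apply: edge_between wD0 ab _.
  by move: da db sD0 mD n5; clear; lia.
case: (pickP H) => [a Ha|noH]; last first.
  have [|e eD0 ue] := edge_avoiding (D := D0) (u := u); first by move: D0u sD0 mD n5; clear; lia.
  have [x [y [eE xy xS yS]]] := complete_pairP (allP wD0 e eD0).
  exists x, y, (rem e D0); rewrite -eE perm_to_rem //; split=> // [||w].
  - by apply: contraNneq ue => <-; rewrite eE set21.
  - by apply: contraNneq ue => <-; rewrite eE set22.
  - by rewrite noH.
case/and3P: (Ha) => aS au da.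
case: (pickP (fun x => H x && (x != a))) => [b /andP[Hb ba]|noH2]; last first.
  have [|y [D1 [yS ya yu pD1]]] := edge_at_avoiding (a := a) (u := u) wD0.
    exact: leq_trans D0u (D0H a Ha).
  exists a, y, D1; split=> // w Hw; have := noH2 w.
  by rewrite Hw /= => /negbFE/eqP ->; rewrite set21.
have [|D1 pD1] := two a b Ha Hb; first by rewrite eq_sym.
case/and3P: (Hb) => bS bu db.
exists a, b, D1; split=> // w /and3P[wS wu dw]; apply: contraT; rewrite !inE negb_or => /andP[wa wb].
have us : uniq [:: w; a; b] by rewrite /= !inE negb_or wa wb eq_sym ba.
have hs : all (fun t => (t \in S) && (#|S| - 1 <= deg D t)) [:: w; a; b].
  by rewrite /= wS aS bS dw da db.
by move: (deg_count wD us hs posD) mD n5; clear; rewrite /=; lia.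
Qed.

(** With minimum degree 2, two vertices of degree at least [#|S| - 2] would already give a degree
    sum of [4 * #|S| - 8]; hence at most one vertex needs care. *)
Lemma remove_degree2 : deg D v = 2 -> (forall x, x \in S -> 2 <= deg D x) ->
  routable (complete S) D.
Proof.
move=> dv posD.
have high1 a b : a \in S -> b \in S -> #|S| - 2 <= deg D a -> #|S| - 2 <= deg D b -> a = b.
  move=> aS bS da db; apply/eqP; apply: contraT => ab.
  have us : uniq [:: a; b] by rewrite /= !inE ab.
  have hs : all (fun t => (t \in S) && (#|S| - 2 <= deg D t)) [:: a; b].
    by rewrite /= aS bS da db.
  by move: (deg_count wD us hs posD) mD n5; clear; rewrite /=; lia.
have [|u [D0 [uS uv pD0]]] := edge_at (a := v) wD; first by rewrite dv.
have [_ wD0 sD0 dD0] := demands_consP wD pD0.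
have D0v : deg D0 v = 1 by move: (dD0 v); rewrite dv set21; clear; lia.
have [|u' [D1 [u'S u'v pD1]]] := edge_at (a := v) wD0; first by rewrite D0v.
have [_ wD1 sD1 dD1] := demands_consP wD0 pD1.
have D1v : deg D1 v = 0 by move: (dD1 v); rewrite D0v set21; clear; lia.
have pD : perm_eq D [:: [set v; u], [set v; u'] & D1].
  by apply: perm_trans pD0 _; rewrite perm_cons.
have neq_v a : #|S| - 2 <= deg D a -> a != v.
  by move=> da; apply: contraTneq da => ->; rewrite dv; move: n5; clear; lia.
have [uu'|uu'] := eqVneq u' u.
  rewrite {u' u'S u'v}uu' in pD1 dD1 pD.
  have D1u : deg D1 u + 2 < #|S|.
    by move: (dD0 u) (dD1 u) (dD uS); rewrite !inE eqxx orbT; clear; lia.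
  (* Both demands at [v] lead to [u]: one takes the edge, the other moves to a fresh [w]. The second
     served demand must be some [[set x; y]] through [v] away from [u], with [x] the vertex of large
     degree if there is one besides [u]. *)
  suff [x [y [D2 [xu yu pD2 cov]]]] : exists x y D2, [/\ x != u, y != u,
      perm_eq D1 ([set x; y] :: D2)
      & forall w, w \in S -> w != u -> w != x -> deg D w + 2 < #|S|].
    have [xyS wD2 sD2 dD2] := demands_consP wD1 pD2.
    move: xyS; rewrite complete_pair => /and3P[xS yS xy].
    move: (dD2 v); rewrite D1v !inE => /esym/eqP.
    rewrite addn_eq0 eqb0 negb_or ![v == _]eq_sym => /andP[/andP[xv yv] /eqP D2v].
    have [|w wS] := ex_fresh (S := S) (s := [:: x; y; u; v]); first exact: n5.
    rewrite !inE !negb_or => /and4P[wx wy wu wv].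
    have pD' : perm_eq D [:: [set v; u], [set x; y], [set v; u] & D2].
      apply: perm_trans pD _; rewrite perm_cons.
      apply: (@perm_trans _ ([:: [set v; u], [set x; y] & D2])); first by rewrite perm_cons.
      exact: (permEl (perm_catCA [:: [set v; u]] [:: [set x; y]] D2)).
    apply: (start pD'); apply: drop_end; rewrite ?inE ?uv //.
    apply: drop_through; rewrite ?inE ?xu ?yu ?xv ?yv //; first exact: sT.
    apply: (@lift_end _ _ _ _ vS _ _ w); rewrite ?inE ?wx ?wy ?wu ?wv //.
      by do 3!apply: sT.
    apply: finish.
    - by rewrite /demands /= complete_pair wS uS wu.
    - by rewrite /= !inE ![v == _]eq_sym (negPf wv) (negPf uv).
    - by move: mD sD0 sD1 sD2; clear; rewrite /=; lia.
    move=> t tS tv; move: (dD0 t) (dD1 t) (dD2 t) (dD tS) (cov t tS).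
    rewrite [deg (_ :: _) t]/= !inE (negPf tv).
    have [->|_] := eqVneq t w; first by rewrite (negPf wu) (negPf wx) (negPf wy); clear; rewrite /=; lia.
    by case: (t == u); case: (t == x); clear; rewrite /=; lia.
  case: (pickP (fun x => [&& x \in S, x != u & #|S| - 2 <= deg D x])) => [a /and3P[aS au da]|noH].
    have [|y [D2 [yS ya yu pD2]]] := edge_at_avoiding (a := a) (u := u) wD1.
      move: (dD0 a) (dD1 a); rewrite !inE (negPf au) (negPf (neq_v a da)).
      by move: da D1u; clear; lia.
    exists a, y, D2; split=> // w wS wu wa; rewrite ltnNge; apply: contraNN wa => dw.
    by apply/eqP; apply: high1 => //; move: dw; clear; lia.
  have [|e eD1 ue] := edge_avoiding (D := D1) (u := u); first by move: D1u sD0 sD1 mD n5; clear; lia.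
  have [x [y [eE xy xS yS]]] := complete_pairP (allP wD1 e eD1).
  exists x, y, (rem e D1); rewrite -eE perm_to_rem //; split=> // [||w wS wu _].
  - by apply: contraNneq ue => <-; rewrite eE set21.
  - by apply: contraNneq ue => <-; rewrite eE set22.
  - by move: (noH w); rewrite wS wu /=; clear; lia.
(* With distinct ends both demands take their edges, which is enough unless a vertex [a] outside
   both has maximal degree and must lose a demand too. *)
case: (pickP (fun x => [&& x \in S, x \notin [:: u; u'] & #|S| - 1 <= deg D x])) => [a|noH]; last first.
  apply: (start pD); apply: drop_end; rewrite ?inE ?uv //.
  apply: drop_end; rewrite ?inE ?uu' ?u'v //; first exact: sT.
  apply: finish => //; first by move: mD sD0 sD1; clear; lia.
  move=> w wS wv; move: (dD0 w) (dD1 w) (dD wS) (noH w).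
  rewrite wS !inE (negPf wv).
  by case: (w == u); case: (w == u'); clear; rewrite /=; lia.
rewrite !inE negb_or => /and3P[aS /andP[au au'] da].
have da2 : #|S| - 2 <= deg D a by apply: leq_trans da; apply: leq_sub2l.
have av := neq_v a da2.
have D1a : deg D1 a = deg D a.
  by move: (dD0 a) (dD1 a); rewrite !inE (negPf au) (negPf au') (negPf av); clear; lia.
have [|y [D2 [yS ya pD2]]] := edge_at (a := a) wD1; first by rewrite D1a; move: da n5; clear; lia.
have [_ wD2 sD2 dD2] := demands_consP wD1 pD2.
move: (dD2 v); rewrite D1v !inE => /esym/eqP.
rewrite addn_eq0 eqb0 negb_or ![v == _]eq_sym => /andP[/andP[_ yv] /eqP D2v].
have pD' : perm_eq D [:: [set v; u], [set v; u'], [set a; y] & D2].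
  by apply: perm_trans pD _; rewrite !perm_cons.
apply: (start pD'); apply: drop_end; rewrite ?inE ?uv //.
apply: drop_end; rewrite ?inE ?uu' ?u'v //; first exact: sT.
have high w : w \in S -> w != a -> deg D w + 2 < #|S|.
  move=> wS; apply: contraNltn => dw; apply/eqP; apply: high1 => //.
  by move: dw; clear; lia.
have [yuu'|] := boolP (y \in [:: u; u']); last first.
  rewrite !inE negb_or => /andP[yu yu'].
  apply: drop_through; rewrite ?inE ?au ?au' ?av ?yu ?yu' ?yv // 1?eq_sym //.
    by do 2!apply: sT.
  apply: finish => //; first by move: mD sD0 sD1 sD2; clear; lia.
  move=> w wS wv; move: (dD0 w) (dD1 w) (dD2 w) (dD wS) (high w wS).
  rewrite !inE (negPf wv).
  by case: (w == a); clear; rewrite /=; lia.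
(* The edge from [v] to [y] is already spent, so the end [a] is moved to a fresh [z], whose degree
   is small because [a] is the only large one. *)
have [|z zS] := ex_fresh (S := S) (s := [:: a; u; u'; v]); first exact: n5.
rewrite !inE !negb_or => /and4P[za zu zu' zv].
have zy : z != y.
  by apply: contraTneq yuu' => <-; rewrite !inE negb_or zu zu'.
apply: (@lift_through _ _ _ _ vS _ _ _ z); rewrite ?inE ?au ?au' ?av ?za ?zu ?zu' ?zv // 1?eq_sym //.
  by do 2!apply: sT.
apply: finish.
- by rewrite /demands /= complete_pair zS yS zy.
- by rewrite /= !inE ![v == _]eq_sym (negPf zv) (negPf yv).
- by move: mD sD0 sD1 sD2; clear; rewrite /=; lia.
move=> w wS wv; move: (dD0 w) (dD1 w) (dD2 w) (dD wS) (high w wS) yuu'.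
rewrite [deg (_ :: _) w]/= !inE (negPf wv).
have [->|wz] := eqVneq w z.
  by rewrite (negPf za) (negPf zy) (negPf zu) (negPf zu'); clear; rewrite /=; lia.
have [->|wy] := eqVneq w y.
  by rewrite (negPf ya); case: (y == u); case: (y == u'); clear; rewrite /=; lia.
by case: (w == a); case: (w == u); case: (w == u'); clear; rewrite /=; lia.
Qed.

(** Minimum degree 3 forces ten vertices and keeps every degree at most [#|S| - 3]. So a vertex may
    gain a demand, and the only concern is to serve two demands while clearing [v]. *)
Lemma remove_degree3 : deg D v = 3 -> (forall x, x \in S -> 3 <= deg D x) ->
  routable (complete S) D.
Proof.
move=> dv posD.
have n10 : 10 <= #|S|.
  by move: (deg_count (k := 0) (s := [::]) wD isT isT posD) mD n5; clear; rewrite /=; lia.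
have low x : x \in S -> deg D x + 2 < #|S|.
  move=> xS; rewrite ltnNge; apply/negP => dx.
  have hs : all (fun t => (t \in S) && (#|S| - 2 <= deg D t)) [:: x].
    by rewrite /= xS leq_subLR addnC dx.
  by move: (deg_count (s := [:: x]) wD isT hs posD) mD n5; clear; rewrite /=; lia.
have [|u [D0 [uS uv pD0]]] := edge_at (a := v) wD; first by rewrite dv.
have [_ wD0 sD0 dD0] := demands_consP wD pD0.
have D0v : deg D0 v = 2 by move: (dD0 v); rewrite dv set21; clear; lia.
have [|u1 [D1 [u1S u1v pD1]]] := edge_at (a := v) wD0; first by rewrite D0v.
have [_ wD1 sD1 dD1] := demands_consP wD0 pD1.
have D1v : deg D1 v = 1 by move: (dD1 v); rewrite D0v set21; clear; lia.
have [|u2 [D2 [u2S u2v pD2]]] := edge_at (a := v) wD1; first by rewrite D1v.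
have [_ wD2 sD2 dD2] := demands_consP wD1 pD2.
have D2v : deg D2 v = 0 by move: (dD2 v); rewrite D1v set21; clear; lia.
have sD : size D = (size D2).+3 by rewrite sD0 sD1 sD2.
have dD3 x : deg D x = (x \in [set v; u]) + (x \in [set v; u1]) + (x \in [set v; u2]) + deg D2 x.
  by rewrite dD0 dD1 dD2 !addnA.
have pD : perm_eq D [:: [set v; u], [set v; u1], [set v; u2] & D2].
  apply: perm_trans pD0 _; rewrite perm_cons; apply: perm_trans pD1 _.
  by rewrite perm_cons.
(* Exactly two of the three demands at [v] agree: one of each kind takes its edge, and the repeated
   one moves to a fresh [w]. *)
have double b a : a \in S -> a != v -> b \in S -> b != v -> a != b ->
    perm_eq D [:: [set v; a], [set v; b], [set v; a] & D2] -> routable (complete S) D.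
  move=> aS av bS bv ab pD'.
  have [|w wS] := ex_fresh (S := S) (s := [:: a; b; v]); first by move: n5; clear; rewrite /=; lia.
  rewrite !inE !negb_or => /and3P[wa wb wv].
  apply: (start pD'); apply: drop_end; rewrite ?inE ?av //.
  apply: drop_end; rewrite ?inE ?bv ?bS 1?eq_sym ?ab //; first exact: sT.
  apply: (@lift_end _ _ _ _ vS _ _ w); rewrite ?inE ?wa ?wb ?wv //; first by do 2!apply: sT.
  apply: finish.
  - by rewrite /demands /= complete_pair wS aS wa.
  - by rewrite /= !inE ![v == _]eq_sym (negPf wv) (negPf av).
  - by move: mD sD; clear; rewrite /=; lia.
  move=> t tS _; have := low t tS; rewrite (deg_perm t pD') /= !inE.
  have [->|_] := eqVneq t w; first by rewrite (negPf wa) (negPf wb) (negPf wv); clear; lia.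
  by case: (t == v); case: (t == a); case: (t == b); clear; rewrite /=; lia.
have [uu1|uu1] := eqVneq u1 u; last first.
  have [u2u|u2u] := eqVneq u2 u.
    by rewrite u2u in pD; rewrite eq_sym in uu1; apply: (double _ _ uS uv u1S u1v uu1).
  have [u2u1|u2u1] := eqVneq u2 u1.
    apply: (double _ _ u1S u1v uS uv uu1); apply: perm_trans pD _; rewrite u2u1.
    exact: (permEl (perm_catCA [:: [set v; u]] [:: [set v; u1]] _)).
  apply: (start pD); apply: drop_end; rewrite ?inE ?uv //.
  apply: drop_end; rewrite ?inE ?uu1 ?u1v //; first exact: sT.
  apply: drop_end; rewrite ?inE ?u2u1 ?u2u ?u2v //; first by do 2!apply: sT.
  apply: finish => //; first by move: mD sD; clear; lia.
  by move=> t tS _; move: (low t tS) (dD3 t); clear; lia.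
have [u2u|u2u] := eqVneq u2 u; last first.
  rewrite eq_sym in u2u; apply: (double _ _ uS uv u2S u2v u2u).
  apply: perm_trans pD _; rewrite uu1 perm_cons.
  exact: (permEl (perm_catCA [:: [set v; u]] [:: [set v; u2]] _)).
rewrite uu1 u2u in pD dD3.
(* All three demands at [v] lead to [u], so only one can take the edge. A demand away from [u] is
   served through [v] to reach two, and the other copies move to [w] and [w']. *)
have [|e eD2 ue] := edge_avoiding (D := D2) (u := u).
  by move: (low u uS) (dD3 u) sD mD n10; clear; lia.
have [x [y [eE xy xS yS]]] := complete_pairP (allP wD2 e eD2).
have pD3 : perm_eq D2 ([set x; y] :: rem e D2) by rewrite -eE perm_to_rem.
have [_ wD3 sD3 dD4] := demands_consP wD2 pD3.
move: (rem e D2) pD3 wD3 sD3 dD4 => D3 pD3 wD3 sD3 dD4.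
move: ue; rewrite eE !inE negb_or ![u == _]eq_sym => /andP[xu yu].
move: (dD4 v); rewrite D2v !inE => /esym/eqP.
rewrite addn_eq0 eqb0 negb_or ![v == _]eq_sym => /andP[/andP[xv yv] /eqP D3v].
have [|w wS] := ex_fresh (S := S) (s := [:: x; y; u; v]); first exact: n5.
rewrite !inE !negb_or => /and4P[wx wy wu wv].
have [|w' w'S] := ex_fresh (S := S) (s := [:: w; x; y; u; v]).
  by apply: leq_trans n10.
rewrite !inE !negb_or => /and5P[w'w w'x w'y w'u w'v].
have pD' : perm_eq D [:: [set v; u], [set x; y], [set v; u], [set v; u] & D3].
  apply: perm_trans pD _; rewrite perm_cons.
  apply: (@perm_trans _ ([:: [set v; u], [set v; u], [set x; y] & D3])); first by rewrite !perm_cons.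
  exact: (permEl (perm_catCA [:: [set v; u]; [set v; u]] [:: [set x; y]] D3)).
apply: (start pD'); apply: drop_end; rewrite ?inE ?uv //.
apply: drop_through; rewrite ?inE ?xu ?yu ?xv ?yv //; first exact: sT.
apply: (@lift_end _ _ _ _ vS _ _ w); rewrite ?inE ?wx ?wy ?wu ?wv //.
  by do 3!apply: sT.
apply: (@routable_perm _ _ ([:: [set v; u], [set w; u] & D3])).
  exact: (permEl (perm_catCA [:: [set v; u]] [:: [set w; u]] D3)).
apply: (@lift_end _ _ _ _ vS _ _ w'); rewrite ?inE ?w'w ?w'x ?w'y ?w'u ?w'v //.
  by do 4!apply: sT.
apply: finish.
- by rewrite /demands /= !complete_pair wS w'S uS wu w'u.
- by rewrite /= !inE ![v == _]eq_sym (negPf wv) (negPf w'v) (negPf uv).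
- by move: mD sD sD3; clear; rewrite /=; lia.
move=> t tS tv; move: (low t tS) (dD3 t) (dD4 t).
rewrite /= !inE (negPf tv).
have [->|_] := eqVneq t w.
  by rewrite (negPf wu) (negPf wx) (negPf wy) eq_sym (negPf w'w); clear; rewrite /=; lia.
by case: (t == w'); case: (t == u); clear; rewrite /=; lia.
Qed.

End RemoveVertex.

(** * Three and four vertices *)

Lemma routable_card3 S D : #|S| = 3 -> demands S D -> size D <= 2 ->
  routable (complete S) D.
Proof.
move=> S3; case: D => [//|e D] /andP[eS].
case: D => [|f [|//]].
  have [x [y [eE xy xS yS]]] := complete_pairP eS.
  by move=> _ _; rewrite eE; apply: routable_edge; rewrite // complete_pair xS yS.
move=> /andP[fS _] _; have [x [y [eE xy xS yS]]] := complete_pairP eS.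
have [a [b [fE ab aS bS]]] := complete_pairP fS.
have [ef|ef] := eqVneq f e; last first.
  rewrite eE fE in ef eS fS *; apply: routable_edge => //.
  apply: routable_edge => //; rewrite in_setD1 ef; exact: fS.
(* Two parallel demands: one takes the edge, the other goes around through the third vertex. *)
have [|z zS] := ex_fresh (S := S) (s := [:: x; y]); first by rewrite S3.
rewrite ef eE !inE negb_or => /andP[zx zy].
apply: routable_edge; first by rewrite -eE.
apply: (@routable_move _ _ _ _ z).
  by rewrite in_setD1 eq_pair complete_pair xS zS [x == z]eq_sym zx (negPf zx) (negPf zy) (negPf xy) andbF.
apply: routable_edge => //.
rewrite !in_setD1 !eq_pair complete_pair zS yS zy (negPf zx) (negPf zy) eqxx /=.
by rewrite [y == x]eq_sym (negPf xy).
Qed.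

(** One demand is served while a vertex is removed, which leaves two on three vertices. The removed
    vertex is isolated or has degree 1: degrees of at least 2 would sum to 8, but the sum is at most
    6. *)
Lemma routable_card4 S D : #|S| = 4 -> demands S D -> size D <= 3 ->
  routable (complete S) D.
Proof.
move=> S4 wD sD.
have S3 v : v \in S -> #|S :\ v| = 3 by move=> vS; move: S4; rewrite (cardsD1 v) vS => -[].
have [/exists_inP [v vS /eqP dv]|/exists_inPn posD] := boolP [exists v in S, deg D v == 0].
  case: D wD sD dv => [//|e D] /andP[eS] wD sD dv; rewrite -/(demands S D) in wD.
  have [x [y [eE xy xS yS]]] := complete_pairP eS.
  move: dv => /eqP; rewrite [deg _ _]/= addn_eq0 eqb0 eE !inE negb_or ![v == _]eq_sym.
  move=> /andP[/andP[xv yv] /eqP dv].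
  apply: (routable_subset (spokes_complete S v (S :\ v))).
  apply: drop_through; rewrite ?inE ?xv ?yv //.
  apply: routable_subset (spokes_base _ _ _) _; apply: routable_card3; first exact: S3.
    exact: demands_isolated.
  exact: sD.
have /exists_inP [v vS /eqP dv] : [exists v in S, deg D v == 1].
  apply: contraT => /exists_inPn no1.
  have pos2 x : x \in S -> 2 <= deg D x.
    by move=> xS; move: (posD x xS) (no1 x xS); case: (deg D x) => [|[|]].
  by move: (deg_count (k := 0) (s := [::]) wD isT isT pos2) sD; rewrite S4; clear; rewrite /=; lia.
have [|u [D0 [uS uv pD]]] := edge_at (a := v) wD; first by rewrite dv.
have [_ wD0 sD0 dD0] := demands_consP wD pD.
apply: routable_perm; first by rewrite perm_sym; exact: pD.
apply: (routable_subset (spokes_complete S v (S :\ v))).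
apply: drop_end; rewrite ?inE ?uv //.
apply: routable_subset (spokes_base _ _ _) _; apply: routable_card3; first exact: S3.
  apply: demands_isolated => //; move: (dD0 v); rewrite dv set21; clear; lia.
by move: sD; rewrite sD0.
Qed.

(** * Adding demands and the induction on vertices *)

Lemma routable_behead E e D : routable E (e :: D) -> routable E D.
Proof. by case=> F [_ _]; apply: routable_subset; apply: subsetDl. Qed.

(** At most three vertices have degree at least [#|S| - 1], so among five or more there are two that
    can be joined by a new demand, possibly parallel to an old one. *)
Lemma ex_extra_demand S D : demands S D -> 5 <= #|S| -> size D + 5 < 2 * #|S| ->
  (forall x, x \in S -> deg D x < #|S|) ->
  exists e, e \in complete S /\ forall x, x \in S -> deg (e :: D) x < #|S|.
Proof.
move=> wD n5 sD dD; pose A := [set x in S | #|S| - 1 <= deg D x].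
have hA : all (fun x => (x \in S) && (#|S| - 1 <= deg D x)) (enum A).
  by apply/allP => x; rewrite mem_enum inE.
have A3 : size (enum A) <= 3.
  move: (deg_count wD (enum_uniq _) hA (fun x _ => leq0n (deg D x))) n5 sD.
  case: (leqP (size (enum A)) 3) => // A4; move: (leq_mul (leqnn (#|S| - 1)) A4).
  by move: (_ * size _) (_ * (_ - _)); clear; lia.
have [|x xS xA] := ex_fresh (S := S) (s := enum A); first by move: A3 n5; clear; lia.
have [|y yS] := ex_fresh (S := S) (s := x :: enum A); first by move: A3 n5; clear; rewrite /=; lia.
rewrite inE negb_or => /andP[yx yA].
exists [set x; y]; rewrite complete_pair xS yS eq_sym yx; split=> // w wS /=.
move: (dD w wS); rewrite mem_enum inE xS /= in xA; rewrite mem_enum inE yS /= in yA.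
rewrite !inE; have [->|_] := eqVneq w x; first by move: xA; clear; rewrite /=; lia.
by have [->|_] := eqVneq w y; first move: yA; clear; rewrite /=; lia.
Qed.

Theorem routable_complete S D : demands S D -> size D + 5 <= 2 * #|S| ->
  (forall x, x \in S -> deg D x < #|S|) -> routable (complete S) D.
Proof.
move: {2}#|S| (leqnn #|S|) => n; elim: n S D => [|n IHn] S D.
  by rewrite leqn0 => /eqP-> _; rewrite muln0 addnS.
move=> Sn wD sD dD.
have [S4|n5] := leqP #|S| 4.
  have [S3|S4'] := leqP #|S| 3; last first.
    by apply: routable_card4 => //; move: S4 S4' sD; clear; lia.
  by apply: routable_card3 => //; move: S3 sD; clear; lia.
(* Inner induction on the slack [k]: demands are added until the edge bound is attained, and
   discarded again by [routable_behead]. *)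
move dk: (2 * #|S| - (size D + 5)) => k.
elim: k D wD sD dD dk => [|k IHk] D wD sD dD dk; last first.
  have [|e [eS edD]] := ex_extra_demand wD n5 _ dD; first by move: sD dk; clear; lia.
  apply: (@routable_behead _ e); apply: IHk => //.
  - by apply/andP.
  - by move: sD dk; clear; rewrite /=; lia.
  - by move: dk; clear; rewrite /=; lia.
have mD : size D + 5 = 2 * #|S| by move: dk sD; clear; lia.
have [v0 v0S _] : exists2 v, v \in S & v \notin [::] by apply: ex_fresh; exact: leq_trans n5.
case: (arg_minnP (deg D) v0S) => v vmem minv; have vS : v \in S := vmem.
have Sv : #|S :\ v| = #|S| - 1 by rewrite (cardsD1 v S) vS add1n subn1.
have IH D' : demands (S :\ v) D' -> size D' + 5 <= 2 * (#|S| - 1) ->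
    (forall x, x \in S :\ v -> deg D' x < #|S| - 1) -> routable (complete (S :\ v)) D'.
  rewrite -Sv => *; apply: IHn => //; rewrite Sv; move: Sn n5; clear; lia.
(* Minimum degree 4 would give a degree sum of at least [4 * #|S|], above [4 * #|S| - 10]. *)
have : deg D v <= 3.
  rewrite leqNgt; apply/negP => v4.
  have pos4 x : x \in S -> 4 <= deg D x by move=> xS; apply: leq_trans v4 (minv x xS).
  by move: (deg_count (k := 0) (s := [::]) wD isT isT pos4) mD; clear; rewrite /=; lia.
move: minv; case dv: (deg D v) => [|[|[|[|//]]]] minv _.
- exact: (remove_isolated vS wD n5 mD dD IH dv).
- exact: (remove_degree1 vS wD n5 mD dD IH dv minv).
- exact: (remove_degree2 vS wD n5 mD dD IH dv minv).
- exact: (remove_degree3 vS wD n5 mD IH dv minv).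
Qed.

End Demands.

(** * From demand lists back to multigraphs *)

Theorem mainTheorem11 (n : nat) (D : multigraph 'I_n)
  (D_loopless : loopless D)
  (D_edges : num_edges D + 5 <= 2 * n)
  (D_degree : forall v : 'I_n, degree D v <= n - 1) :
  realizable (complete_graph n) D.
Proof.
apply: realizable_of_routable; apply: routable_complete.
- apply/allP => _ /mapP [e _ ->]; rewrite [mem _ _]complete_pair !inE.
  exact: D_loopless.
- by rewrite size_map -cardE cardsT card_ord.
move=> v _; rewrite cardsT card_ord.
(* As a set, a demand counts once at [v] whichever end is there; [degree] adds the two ends
   separately and bounds the size of this union. *)
have degE : deg [seq [set mend1 e; mend2 e] | e <- enum (medge D)] v
    = #|[set e : medge D | mend1 e == v] :|: [set e | mend2 e == v]|.
  rewrite /deg count_map enumT cardE /enum_mem size_filter; apply: eq_count => e.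
  by rewrite /= !inE ![v == _]eq_sym.
rewrite degE; apply: leq_ltn_trans (leq_trans (leq_card_setU _ _) (D_degree v)) _.
(* The vertex [v] itself shows that [n] is positive, so [n - 1] is strictly below [n]. *)
by rewrite subn1 prednK // (leq_trans _ (ltn_ord v)).
Qed.
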